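(* Let $X$ be a non-empty set, let $S=\mathrm{BRestr}\langle X\mid R\rangle$ be a birestriction monoid given by a presentation, and let $\tilde S=\mathrm{Inv}\langle X\mid \psi(R)\rangle$ be its universal inverse monoid. Then the maps $\psi\colon P(S)\to E(\tilde S)$ and $D\colon E(\tilde S)\to P(S)$ are well defined and are mutually inverse isomorphisms of semilattices.
   Context: A birestriction monoid is an algebra $(S;\cdot,{}^*,{}^+,1)$ such that $(S;\cdot,1)$ is a monoid and for all $x,y$: $xx^*=x$, $x^*y^*=y^*x^*$, $(xy^* )^*=x^*y^*$, $x^*y=y(xy)^*$; $x^+x=x$, $x^+y^+=y^+x^+$, $(x^+y)^+=x^+y^+$, $xy^+=(xy)^+x$; $(x^+)^*=x^+$, $(x^* )^+=x^*$. Its projections $P(S)=\{s^*:s\in S\}=\{s^+:s\in S\}$ form a semilattice. An inverse monoid is regarded as a birestriction monoid via $a^*=a^{-1}a$, $a^+=aa^{-1}$; $E(\cdot)$ is its semilattice of idempotents. A $(2,1,1,0)$-morphism preserves $\cdot,{}^*,{}^+,1$. $\mathsf{FBR}(X)$ and $\mathsf{FI}(X)$ are the free birestriction monoid and the free inverse monoid on $X$. $\mathrm{BRestr}\langle X\mid R\rangle$, where $R$ is a set of relations $u=v$ with $u,v\in\mathsf{FBR}(X)$, is the quotient of $\mathsf{FBR}(X)$ by the congruence generated by $R$. The map $\psi\colon\mathsf{FBR}(X)\to\mathsf{FI}(X)$ is the $(2,1,1,0)$-morphism that is identical on $X$; $\psi(R)$ is the set of relations $\psi(u)=\psi(v)$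 for $u=v$ in $R$, and $\mathrm{Inv}\langle X\mid\psi(R)\rangle$ is the inverse monoid with this presentation. The identity map on $X$ extends to a $(2,1,1,0)$-morphism $\psi\colon S\to\tilde S$, which restricts to $\psi\colon P(S)\to E(\tilde S)$. For words $u\in(X\cup X^{-1})^*$ define $D_u\in P(S)$ recursively: $D_1=1$ for the empty word; $D_{wx}=(D_w x)^*$ and $D_{wx^{-1}}=(xD_w)^+$ for $w\in(X\cup X^{-1})^*$ and $x\in X$ (computed in $S$). The map $D\colon E(\tilde S)\to P(S)$ sends an idempotent that is the value in $\tilde S$ of a word $u$ to $D_u$. *)

(* Defs.v *)
From HB Require Import structures.
From mathcomp Require Import all_boot boolp.

Set Implicit Arguments.
Unset Strict Implicit.
Unset Printing Implicit Defensive.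

Local Open Scope quotient_scope.
Local Open Scope group_scope.

(* The unary operations are written [star x] and [plus x]: the postfix form  *)
(* of the latter would clash with the power notation [x ^+ n].               *)
HB.mixin Record hasStarPlus T := {
  star : T -> T;
  plus : T -> T
}.

(* Algebras of signature (2,1,1,0), with no axioms.                          *)
#[short(type="brAlgType")]
HB.structure Definition BRAlgebra :=
  {T of hasStarPlus T & BaseUMagma T & Choice T}.

HB.mixin Record BRAlgebra_isBirestriction T of BRAlgebra T & Monoid T := {
  mulg_star : forall x : T, x * star x = x;
  starC : forall x y : T, star x * star y = star y * star x;
  star_mulr : forall x y : T, star (x * star y) = star x * star y;
  star_mull : forall x y : T, star x * y = y * star (x * y);
  plus_mulg : forall x : T, plus x * x = x;
  plusC : forall x y : T, plus x * plus y = plus y * plus x;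
  plus_mull : forall x y : T, plus (plus x * y) = plus x * plus y;
  plus_mulr : forall x y : T, x * plus y = plus (x * y) * x;
  star_plus : forall x : T, star (plus x) = plus x;
  plus_star : forall x : T, plus (star x) = star x
}.

#[short(type="brMonoidType")]
HB.structure Definition BirestrictionMonoid :=
  {T of BRAlgebra T & Monoid T & BRAlgebra_isBirestriction T}.

HB.mixin Record isBRMorphism (S T : brAlgType) (f : S -> T) := {
  brmorph_star : {morph f : x / star x};
  brmorph_plus : {morph f : x / plus x}
}.

HB.structure Definition BRMorphism (S T : brAlgType) :=
  {f of isBRMorphism S T f & isUMagmaMorphism S T f}.

Notation "{ 'brmorphism' S -> T }" := (BRMorphism.type S%type T%type)
  (at level 0, S at level 98, T at level 99) : type_scope.

Section BirestrictionTheory.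
Variable S : brMonoidType.
Implicit Types x y : S.

Lemma star1 : star (1 : S) = 1.
Proof. by rewrite -[LHS]mul1g mulg_star. Qed.

Lemma starg_idem x : star x * star x = star x.
Proof. by rewrite -star_mulr mulg_star. Qed.

Definition is_proj : pred S := fun s => `[< exists t : S, s = star t >].

Lemma is_projP s : reflect (exists t : S, s = star t) (s \in is_proj).
Proof. exact: asboolP. Qed.

Lemma is_proj_plus s : (s \in is_proj) <-> exists t : S, s = plus t.
Proof.
split=> [/is_projP[t ->]|[t ->]]; first by exists (star t); rewrite plus_star.
by apply/is_projP; exists (plus t); rewrite star_plus.
Qed.

Lemma is_proj_closed : umagma_closed is_proj.
Proof.
split; first by apply/is_projP; exists 1; rewrite star1.
move=> _ _ /is_projP[x ->] /is_projP[y ->]; apply/is_projP.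
by exists (x * star y); rewrite star_mulr.
Qed.

(* A monoid under the product of S, and by projC and projgg a semilattice. *)
Record proj := Proj { proj_val : S; _ : proj_val \in is_proj }.
HB.instance Definition _ := [isSub for proj_val].
HB.instance Definition _ := [Choice of proj by <:].
HB.instance Definition _ :=
  SubChoice_isSubMonoid.Build S is_proj proj is_proj_closed.

Lemma projC (p q : proj) : p * q = q * p.
Proof.
apply: val_inj; rewrite !gmulfM.
by case: p q => [_ /= /is_projP[x ->]] [_ /= /is_projP[y ->]]; exact: starC.
Qed.

Lemma projgg (p : proj) : p * p = p.
Proof.
apply: val_inj; rewrite gmulfM.
by case: p => [_ /= /is_projP[x ->]]; exact: starg_idem.
Qed.

End BirestrictionTheory.

(* Inverse monoids are axiomatised as the usual variety of unary monoids     *)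
(* (see invm_uniq below for uniqueness of inverses); the last two fields fix *)
(* the birestriction structure carried by an inverse monoid.                 *)
HB.mixin Record BirestrictionMonoid_isInverseMonoid T
    of StarMonoid T & BirestrictionMonoid T := {
  mulgVg : forall x : T, x * x^-1 * x = x;
  mulgVC : forall x y : T, (x * x^-1) * (y * y^-1) = (y * y^-1) * (x * x^-1);
  starE : forall x : T, star x = x^-1 * x;
  plusE : forall x : T, plus x = x * x^-1
}.

#[short(type="invMonoidType")]
HB.structure Definition InverseMonoid :=
  {T of StarMonoid T & BirestrictionMonoid T
      & BirestrictionMonoid_isInverseMonoid T}.

HB.factory Record StarMonoid_isInverseMonoid T of StarMonoid T := {
  mulgVg : forall x : T, x * x^-1 * x = x;
  mulgVC : forall x y : T, (x * x^-1) * (y * y^-1) = (y * y^-1) * (x * x^-1)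
}.

HB.builders Context T of StarMonoid_isInverseMonoid T.

Let st (x : T) : T := x^-1 * x.
Let pl (x : T) : T := x * x^-1.

Let plC x y : pl x * pl y = pl y * pl x. Proof. exact: mulgVC. Qed.
Let stE x : st x = pl x^-1. Proof. by rewrite /st /pl invgK. Qed.
Let stC x y : st x * st y = st y * st x. Proof. by rewrite !stE plC. Qed.
Let stplC x y : st x * pl y = pl y * st x. Proof. by rewrite stE plC. Qed.
Let plV x : (pl x)^-1 = pl x. Proof. by rewrite /pl invgM invgK. Qed.
Let stV x : (st x)^-1 = st x. Proof. by rewrite stE plV. Qed.
Let pll x : pl x * x = x. Proof. exact: mulgVg. Qed.
Let rst x : x * st x = x. Proof. by rewrite /st mulgA mulgVg. Qed.
Let plpl x : pl x * pl x = pl x. Proof. by rewrite {2 3}/pl mulgA pll. Qed.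
Let stst x : st x * st x = st x. Proof. by rewrite stE plpl. Qed.

Let star_mulr x y : st (x * st y) = st x * st y.
Proof.
rewrite {1}/st invgM stV mulgA -(mulgA _ x^-1) -/(st x).
by rewrite (stC y x) -mulgA stst.
Qed.
Let star_mull x y : st x * y = y * st (x * y).
Proof.
by rewrite {2}/st invgM !mulgA -/(pl y) -(mulgA (pl y)) -/(st x) -(stplC x y)
           -(mulgA (st x)) pll.
Qed.
Let plus_mull x y : pl (pl x * y) = pl x * pl y.
Proof.
by rewrite {1}/pl invgM plV mulgA -(mulgA _ y) -/(pl y) (plC x y) -(mulgA (pl y)) plpl (plC y x).
Qed.
Let plus_mulr x y : x * pl y = pl (x * y) * x.
Proof.
by rewrite {2}/pl invgM -!mulgA -/(st x) (mulgA y) -/(pl y) -(stplC x y)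
           (mulgA x (st x)) rst.
Qed.
Let star_plus x : st (pl x) = pl x.
Proof. by rewrite /st plV plpl. Qed.
Let plus_star x : pl (st x) = st x.
Proof. by rewrite /pl stV stst. Qed.

HB.instance Definition _ := hasStarPlus.Build T st pl.
HB.instance Definition _ := BRAlgebra_isBirestriction.Build T
  rst stC star_mulr star_mull pll plC plus_mull plus_mulr star_plus plus_star.
HB.instance Definition _ := BirestrictionMonoid_isInverseMonoid.Build T
  mulgVg mulgVC (fun=> erefl) (fun=> erefl).

HB.end.

Section InverseTheory.
Variable M : invMonoidType.
Implicit Types e f x y : M.

Lemma idemV e : e * e = e -> e^-1 = e.
Proof.
move=> ee; have e'e' : e^-1 * e^-1 = e^-1 by rewrite -invgM ee.
have eq1 : e = (e * e^-1) * (e^-1 * e).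
  by rewrite mulgA -(mulgA _ e^-1 e^-1) e'e' mulgVg.
have eq2 : e^-1 = (e^-1 * e) * (e * e^-1).
  by rewrite mulgA -(mulgA _ e e) ee; have := mulgVg e^-1; rewrite invgK.
by rewrite eq2 [RHS]eq1; have := mulgVC e^-1 e; rewrite invgK.
Qed.

Lemma idemC e f : e * e = e -> f * f = f -> e * f = f * e.
Proof.
move=> ee ff; have := mulgVC e f.
by rewrite (idemV ee) (idemV ff) ee ff.
Qed.

Lemma invm_uniq x y : x * y * x = x -> y * x * y = y -> y = x^-1.
Proof.
move=> xyx yxy.
have i1 : (x * y) * (x * y) = x * y by rewrite mulgA xyx.
have i2 : (x * x^-1) * (x * x^-1) = x * x^-1 by rewrite mulgA mulgVg.
have i3 : (y * x) * (y * x) = y * x by rewrite mulgA yxy.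
have i4 : (x^-1 * x) * (x^-1 * x) = x^-1 * x by rewrite -mulgA (mulgA x) mulgVg.
have xx' : x * y = x * x^-1.
  by rewrite -[in LHS](mulgVg x) -mulgA (idemC i2 i1) mulgA xyx.
have yx' : y * x = x^-1 * x.
  rewrite -[in LHS](mulgVg x) -(mulgA x x^-1) (mulgA y) (idemC i3 i4).
  by rewrite -(mulgA x^-1) (mulgA x y) xyx.
rewrite -[y]yxy yx' -mulgA xx' mulgA.
by have := mulgVg x^-1; rewrite invgK.
Qed.

Definition is_idem : pred M := fun x => x * x == x.

Lemma is_idem_closed : umagma_closed is_idem.
Proof.
split; first by rewrite unfold_in /is_idem mulg1.
move=> e f; rewrite !unfold_in /is_idem => /eqP ee /eqP ff; apply/eqP.
by rewrite mulgA -(mulgA e) -(idemC ee ff) mulgA ee -mulgA ff.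
Qed.

(* A monoid under the product of M, and by idemgC and idemgg a semilattice. *)
Record idem := Idem { idem_val : M; _ : idem_val \in is_idem }.
HB.instance Definition _ := [isSub for idem_val].
HB.instance Definition _ := [Choice of idem by <:].
HB.instance Definition _ :=
  SubChoice_isSubMonoid.Build M is_idem idem is_idem_closed.

Lemma idemgg (e : idem) : e * e = e.
Proof. by apply: val_inj; rewrite gmulfM; case: e => x /= /eqP. Qed.

Lemma idemgC (e f : idem) : e * f = f * e.
Proof.
apply: val_inj; rewrite !gmulfM.
by case: e f => [x /= /eqP xx] [y /= /eqP yy]; exact: idemC.
Qed.

End InverseTheory.

Section BRQuotient.
Variables (T : brAlgType) (R : T -> T -> Prop).

Inductive br_cong : T -> T -> Prop :=
| BrCongIncl x y : R x y -> br_cong x y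
| BrCongRefl x : br_cong x x
| BrCongSym x y : br_cong x y -> br_cong y x
| BrCongTrans x y z : br_cong x y -> br_cong y z -> br_cong x z
| BrCongMul x x' y y' :
    br_cong x x' -> br_cong y y' -> br_cong (x * y) (x' * y')
| BrCongStar x x' : br_cong x x' -> br_cong (star x) (star x')
| BrCongPlus x x' : br_cong x x' -> br_cong (plus x) (plus x').

Definition br_congb : rel T := fun x y => `[< br_cong x y >].

Lemma br_congb_equiv : equiv_class_of br_congb.
Proof.
split=> [x|x y|y x z].
- by apply/asboolP; exact: BrCongRefl.
- by apply/asboolP/asboolP; exact: BrCongSym.
- by move=> /asboolP xy /asboolP yz; apply/asboolP; exact: BrCongTrans xy yz.
Qed.

Canonical br_cong_equiv := EquivRelPack br_congb_equiv.

Definition br_quot := {eq_quot br_congb}.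
HB.instance Definition _ := Choice.on br_quot.

Definition br_pi (x : T) : br_quot := \pi_{eq_quot br_congb} x.
Definition br_repr (a : br_quot) : T := repr a.

Lemma br_reprK : cancel br_repr br_pi. Proof. exact: reprK. Qed.

Lemma br_piP x y : br_pi x = br_pi y <-> br_cong x y.
Proof. by split=> [/eqmodP/asboolP|xy]; last exact/eqmodP/asboolP. Qed.

Lemma br_piK x : br_cong (br_repr (br_pi x)) x.
Proof. by apply/br_piP; rewrite br_reprK. Qed.

Lemma br_piE a : exists x, a = br_pi x.
Proof. by exists (br_repr a); rewrite br_reprK. Qed.

HB.instance Definition _ := hasMul.Build br_quot
  (fun a b => br_pi (br_repr a * br_repr b)).
HB.instance Definition _ := hasOne.Build br_quot (br_pi 1).
HB.instance Definition _ := hasStarPlus.Build br_quot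
  (fun a => br_pi (star (br_repr a))) (fun a => br_pi (plus (br_repr a))).

Lemma br_piM x y : br_pi (x * y) = br_pi x * br_pi y.
Proof.
by apply/br_piP/BrCongSym/BrCongMul; exact: br_piK.
Qed.
Lemma br_pi1 : br_pi 1 = 1. Proof. by []. Qed.
Lemma br_pi_star x : br_pi (star x) = star (br_pi x).
Proof. by apply/br_piP/BrCongSym/BrCongStar; exact: br_piK. Qed.
Lemma br_pi_plus x : br_pi (plus x) = plus (br_pi x).
Proof. by apply/br_piP/BrCongSym/BrCongPlus; exact: br_piK. Qed.

HB.instance Definition _ :=
  isUMagmaMorphism.Build T br_quot br_pi (conj br_pi1 br_piM).
HB.instance Definition _ :=
  isBRMorphism.Build T br_quot br_pi br_pi_star br_pi_plus.

Lemma br_cong_morph (M : brAlgType) (f : {brmorphism T -> M}) :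
  (forall x y, R x y -> f x = f y) -> forall x y, br_cong x y -> f x = f y.
Proof.
move=> fR x y; elim=> //.
- by move=> {}x {}y z _ -> _ ->.
- by move=> x1 x2 y1 y2 _ e1 _ e2; rewrite !gmulfM /= e1 e2.
- by move=> x1 x2 _ e; rewrite !brmorph_star e.
- by move=> x1 x2 _ e; rewrite !brmorph_plus e.
Qed.

End BRQuotient.

Inductive br_axiom (T : brAlgType) : T -> T -> Prop :=
| BrMulA x y z : br_axiom (x * (y * z)) (x * y * z)
| BrMul1 x : br_axiom (1 * x) x
| Br1Mul x : br_axiom (x * 1) x
| BrMulStar x : br_axiom (x * star x) x
| BrStarC x y : br_axiom (star x * star y) (star y * star x)
| BrStarMulr x y : br_axiom (star (x * star y)) (star x * star y)
| BrStarMull x y : br_axiom (star x * y) (y * star (x * y))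
| BrPlusMul x : br_axiom (plus x * x) x
| BrPlusC x y : br_axiom (plus x * plus y) (plus y * plus x)
| BrPlusMull x y : br_axiom (plus (plus x * y)) (plus x * plus y)
| BrPlusMulr x y : br_axiom (x * plus y) (plus (x * y) * x)
| BrStarPlus x : br_axiom (star (plus x)) (plus x)
| BrPlusStar x : br_axiom (plus (star x)) (star x).

Ltac br_axiom_intro :=
  first [ exact: BrMulA | exact: BrMul1 | exact: Br1Mul | exact: BrMulStar
        | exact: BrStarC | exact: BrStarMulr | exact: BrStarMull
        | exact: BrPlusMul | exact: BrPlusC | exact: BrPlusMull
        | exact: BrPlusMulr | exact: BrStarPlus | exact: BrPlusStar ].

Lemma br_axiom_sound (M : brMonoidType) (x y : M) : br_axiom x y -> x = y.
Proof.
case=> *; by [exact: mulgA|exact: mul1g|exact: mulg1|exact: mulg_star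
 |exact: starC|exact: star_mulr|exact: star_mull|exact: plus_mulg
 |exact: plusC|exact: plus_mull|exact: plus_mulr|exact: star_plus
 |exact: plus_star].
Qed.

Lemma br_axiom_morph (T M : brAlgType) (f : {brmorphism T -> M}) x y :
  br_axiom x y -> br_axiom (f x) (f y).
Proof.
case=> *; do ?rewrite ?(gmulfM, gmulf1, brmorph_star, brmorph_plus) /=.
all: br_axiom_intro.
Qed.

Section BRQuotientMonoid.
Variables (T : brAlgType) (R : T -> T -> Prop).
Hypothesis ax : forall x y : T, br_axiom x y -> br_pi R x = br_pi R y.
Notation Q := (br_quot R).

Let piE := (br_piM R, br_pi_star R, br_pi_plus R, br_pi1 R).

Lemma br_quotA : associative (@mul Q).
Proof.
move=> a b c; case: (br_piE a) => x ->; case: (br_piE b) => y ->; case: (br_piE c) => z ->.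
by have := ax (BrMulA x y z); rewrite !piE.
Qed.
Lemma br_quot1g : left_id 1 (@mul Q).
Proof.
move=> a; case: (br_piE a) => x ->.
by have := ax (BrMul1 x); rewrite !piE.
Qed.
Lemma br_quotg1 : right_id 1 (@mul Q).
Proof.
move=> a; case: (br_piE a) => x ->.
by have := ax (Br1Mul x); rewrite !piE.
Qed.
Lemma br_quot_mulg_star (a : Q) : a * star a = a.
Proof.
case: (br_piE a) => x ->.
by have := ax (BrMulStar x); rewrite !piE.
Qed.
Lemma br_quot_starC (a b : Q) : star a * star b = star b * star a.
Proof.
case: (br_piE a) => x ->; case: (br_piE b) => y ->.
by have := ax (BrStarC x y); rewrite !piE.
Qed.
Lemma br_quot_star_mulr (a b : Q) : star (a * star b) = star a * star b.
Proof.
case: (br_piE a) => x ->; case: (br_piE b) => y ->.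
by have := ax (BrStarMulr x y); rewrite !piE.
Qed.
Lemma br_quot_star_mull (a b : Q) : star a * b = b * star (a * b).
Proof.
case: (br_piE a) => x ->; case: (br_piE b) => y ->.
by have := ax (BrStarMull x y); rewrite !piE.
Qed.
Lemma br_quot_plus_mulg (a : Q) : plus a * a = a.
Proof.
case: (br_piE a) => x ->.
by have := ax (BrPlusMul x); rewrite !piE.
Qed.
Lemma br_quot_plusC (a b : Q) : plus a * plus b = plus b * plus a.
Proof.
case: (br_piE a) => x ->; case: (br_piE b) => y ->.
by have := ax (BrPlusC x y); rewrite !piE.
Qed.
Lemma br_quot_plus_mull (a b : Q) : plus (plus a * b) = plus a * plus b.
Proof.
case: (br_piE a) => x ->; case: (br_piE b) => y ->.
by have := ax (BrPlusMull x y); rewrite !piE.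
Qed.
Lemma br_quot_plus_mulr (a b : Q) : a * plus b = plus (a * b) * a.
Proof.
case: (br_piE a) => x ->; case: (br_piE b) => y ->.
by have := ax (BrPlusMulr x y); rewrite !piE.
Qed.
Lemma br_quot_star_plus (a : Q) : star (plus a) = plus a.
Proof.
case: (br_piE a) => x ->.
by have := ax (BrStarPlus x); rewrite !piE.
Qed.
Lemma br_quot_plus_star (a : Q) : plus (star a) = star a.
Proof.
case: (br_piE a) => x ->.
by have := ax (BrPlusStar x); rewrite !piE.
Qed.

End BRQuotientMonoid.

Inductive brterm (X : Type) :=
| BRGen of X
| BROne
| BRMul of brterm X & brterm X
| BRStar of brterm X
| BRPlus of brterm X.
Arguments BROne {X}.

HB.instance Definition _ X := gen_eqMixin (brterm X).
HB.instance Definition _ X := gen_choiceMixin (brterm X).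
HB.instance Definition _ X := hasMul.Build (brterm X) (@BRMul X).
HB.instance Definition _ X := hasOne.Build (brterm X) BROne.
HB.instance Definition _ X := hasStarPlus.Build (brterm X) (@BRStar X) (@BRPlus X).

Definition FBR (X : Type) := br_quot (@br_axiom (brterm X)).

Section FBR.
Variable X : Type.

Let ax (x y : brterm X) :
  br_axiom x y -> br_pi (@br_axiom (brterm X)) x = br_pi (@br_axiom _) y.
Proof. by move=> xy; apply/br_piP; exact: BrCongIncl. Qed.

HB.instance Definition _ := BRAlgebra.on (FBR X).
HB.instance Definition _ := Magma_isSemigroup.Build (FBR X) (br_quotA ax).
HB.instance Definition _ :=
  BaseUMagma_isUMagma.Build (FBR X) (br_quot1g ax) (br_quotg1 ax).
HB.instance Definition _ := BRAlgebra_isBirestriction.Build (FBR X)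
  (br_quot_mulg_star ax) (br_quot_starC ax) (br_quot_star_mulr ax)
  (br_quot_star_mull ax) (br_quot_plus_mulg ax) (br_quot_plusC ax)
  (br_quot_plus_mull ax) (br_quot_plus_mulr ax) (br_quot_star_plus ax)
  (br_quot_plus_star ax).

Definition FBR_gen (x : X) : FBR X := br_pi _ (BRGen x).

End FBR.

Section FBRUniversal.
Variables (X : Type) (M : brMonoidType) (f : X -> M).

Fixpoint br_eval (t : brterm X) : M :=
  match t with
  | BRGen x => f x
  | BROne => 1
  | BRMul t1 t2 => br_eval t1 * br_eval t2
  | BRStar t1 => star (br_eval t1)
  | BRPlus t1 => plus (br_eval t1)
  end.

HB.instance Definition _ := isUMagmaMorphism.Build (brterm X) M br_eval
  (conj erefl (fun _ _ => erefl)).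
HB.instance Definition _ := isBRMorphism.Build (brterm X) M br_eval
  (fun=> erefl) (fun=> erefl).

Definition FBR_lift (a : FBR X) : M := br_eval (br_repr a).

Lemma FBR_lift_pi t : FBR_lift (br_pi _ t) = br_eval t.
Proof.
apply: (br_cong_morph (f := br_eval)) (br_piK _ t) => x y xy.
exact/br_axiom_sound/br_axiom_morph.
Qed.

Lemma FBR_lift_gen x : FBR_lift (FBR_gen x) = f x.
Proof. exact: FBR_lift_pi. Qed.

Let lift1 : FBR_lift 1 = 1. Proof. exact: FBR_lift_pi. Qed.
Let liftM : {morph FBR_lift : a b / a * b}.
Proof. by move=> a b; rewrite /= [LHS]FBR_lift_pi. Qed.
Let lift_star : {morph FBR_lift : a / star a}.
Proof. by move=> a; rewrite /= [LHS]FBR_lift_pi. Qed.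
Let lift_plus : {morph FBR_lift : a / plus a}.
Proof. by move=> a; rewrite /= [LHS]FBR_lift_pi. Qed.

HB.instance Definition _ :=
  isUMagmaMorphism.Build (FBR X) M FBR_lift (conj lift1 liftM).
HB.instance Definition _ :=
  isBRMorphism.Build (FBR X) M FBR_lift lift_star lift_plus.

Lemma FBR_lift_uniq (g : {brmorphism FBR X -> M}) :
  (forall x, g (FBR_gen x) = f x) -> g =1 FBR_lift.
Proof.
move=> gf a; have [t ->] := br_piE a; rewrite FBR_lift_pi.
elim: t => /= [x||t1 e1 t2 e2|t e|t e].
- exact: gf.
- by rewrite -[RHS](gmulf1 (s := g)).
- by rewrite -e1 -e2 -gmulfM -br_piM.
- by rewrite -e -brmorph_star -br_pi_star.
- by rewrite -e -brmorph_plus -br_pi_plus.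
Qed.

End FBRUniversal.

Definition BRestr (X : Type) (R : FBR X -> FBR X -> Prop) := br_quot R.

Section BRestr.
Variables (X : Type) (R : FBR X -> FBR X -> Prop).

Let ax (x y : FBR X) : br_axiom x y -> br_pi R x = br_pi R y.
Proof. by move=> /br_axiom_sound ->. Qed.

HB.instance Definition _ := BRAlgebra.on (BRestr R).
HB.instance Definition _ := Magma_isSemigroup.Build (BRestr R) (br_quotA ax).
HB.instance Definition _ :=
  BaseUMagma_isUMagma.Build (BRestr R) (br_quot1g ax) (br_quotg1 ax).
HB.instance Definition _ := BRAlgebra_isBirestriction.Build (BRestr R)
  (br_quot_mulg_star ax) (br_quot_starC ax) (br_quot_star_mulr ax)
  (br_quot_star_mull ax) (br_quot_plus_mulg ax) (br_quot_plusC ax)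
  (br_quot_plus_mull ax) (br_quot_plus_mulr ax) (br_quot_star_plus ax)
  (br_quot_plus_star ax).

Definition BRestr_gen (x : X) : BRestr R := br_pi R (FBR_gen x).

End BRestr.

Section StarQuotient.
Variables (T : starMonoidType) (R : T -> T -> Prop).

Inductive sm_cong : T -> T -> Prop :=
| SmCongIncl x y : R x y -> sm_cong x y
| SmCongRefl x : sm_cong x x
| SmCongSym x y : sm_cong x y -> sm_cong y x
| SmCongTrans x y z : sm_cong x y -> sm_cong y z -> sm_cong x z
| SmCongMul x x' y y' :
    sm_cong x x' -> sm_cong y y' -> sm_cong (x * y) (x' * y')
| SmCongInv x x' : sm_cong x x' -> sm_cong x^-1 x'^-1.

Definition sm_congb : rel T := fun x y => `[< sm_cong x y >].

Lemma sm_congb_equiv : equiv_class_of sm_congb.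
Proof.
split=> [x|x y|y x z].
- by apply/asboolP; exact: SmCongRefl.
- by apply/asboolP/asboolP; exact: SmCongSym.
- by move=> /asboolP xy /asboolP yz; apply/asboolP; exact: SmCongTrans xy yz.
Qed.

Canonical sm_cong_equiv := EquivRelPack sm_congb_equiv.

Definition sm_quot := {eq_quot sm_congb}.
HB.instance Definition _ := Choice.on sm_quot.

Definition sm_pi (x : T) : sm_quot := \pi_{eq_quot sm_congb} x.
Definition sm_repr (a : sm_quot) : T := repr a.

Lemma sm_reprK : cancel sm_repr sm_pi. Proof. exact: reprK. Qed.

Lemma sm_piP x y : sm_pi x = sm_pi y <-> sm_cong x y.
Proof. by split=> [/eqmodP/asboolP|xy]; last exact/eqmodP/asboolP. Qed.

Lemma sm_piK x : sm_cong (sm_repr (sm_pi x)) x.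
Proof. by apply/sm_piP; rewrite sm_reprK. Qed.

Lemma sm_piE a : exists x, a = sm_pi x.
Proof. by exists (sm_repr a); rewrite sm_reprK. Qed.

Let qmul a b := sm_pi (sm_repr a * sm_repr b).
Let qinv a := sm_pi (sm_repr a)^-1.

Let qmulE x y : qmul (sm_pi x) (sm_pi y) = sm_pi (x * y).
Proof. by apply/sm_piP/SmCongMul; exact: sm_piK. Qed.
Let qinvE x : qinv (sm_pi x) = sm_pi x^-1.
Proof. by apply/sm_piP/SmCongInv; exact: sm_piK. Qed.

Let qmulA : associative qmul.
Proof.
move=> a b c; have [x ->] := sm_piE a; have [y ->] := sm_piE b.
by have [z ->] := sm_piE c; rewrite !qmulE mulgA.
Qed.
Let qmul1 : left_id (sm_pi 1) qmul.
Proof. by move=> a; have [x ->] := sm_piE a; rewrite qmulE mul1g. Qed.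
Let qinvK : involutive qinv.
Proof. by move=> a; have [x ->] := sm_piE a; rewrite !qinvE invgK. Qed.
Let qinvM : {morph qinv : a b / qmul a b >-> qmul b a}.
Proof.
move=> a b; have [x ->] := sm_piE a; have [y ->] := sm_piE b.
by rewrite !(qmulE, qinvE) invgM.
Qed.

HB.instance Definition _ := isStarMonoid.Build sm_quot
  qmulA qmul1 qinvK qinvM.

Lemma sm_piM x y : sm_pi (x * y) = sm_pi x * sm_pi y.
Proof. exact/esym/qmulE. Qed.
Lemma sm_pi1 : sm_pi 1 = 1. Proof. by []. Qed.
Lemma sm_piV x : sm_pi x^-1 = (sm_pi x)^-1.
Proof. exact/esym/qinvE. Qed.

HB.instance Definition _ :=
  isUMagmaMorphism.Build T sm_quot sm_pi (conj sm_pi1 sm_piM).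

End StarQuotient.

(* Pos x stands for the letter x, Neg x for the letter x^-1. *)
Inductive letter (X : Type) := Pos of X | Neg of X.

Definition letter_inv X (a : letter X) : letter X :=
  match a with Pos x => Neg x | Neg x => Pos x end.

Definition word (X : Type) := seq (letter X).

Section Words.
Variable X : Type.

Definition word_inv (u : word X) : word X := rev (map (@letter_inv X) u).

Let catA : associative (@cat (letter X)). Proof. exact: catA. Qed.
Let cat0s : left_id nil (@cat (letter X)). Proof. exact: cat0s. Qed.
Let wordVK : involutive word_inv.
Proof.
move=> u; rewrite /word_inv map_rev revK -map_comp -[RHS]map_id.
by apply: eq_map => -[].
Qed.
Let wordVM : {morph word_inv : u v / u ++ v >-> v ++ u}.
Proof. by move=> u v; rewrite /word_inv map_cat rev_cat. Qed.

HB.instance Definition _ := gen_eqMixin (word X).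
HB.instance Definition _ := gen_choiceMixin (word X).
HB.instance Definition _ := isStarMonoid.Build (word X)
  catA cat0s wordVK wordVM.

End Words.

Definition letter_val X (M : starMonoidType) (f : X -> M) (a : letter X) : M :=
  match a with Pos x => f x | Neg x => (f x)^-1 end.

Definition word_val X (M : starMonoidType) (f : X -> M) (u : word X) : M :=
  \prod_(a <- u) letter_val f a.

Inductive wagner (X : Type) : word X -> word X -> Prop :=
| WagnerReg u : wagner (u * u^-1 * u) u
| WagnerComm u v : wagner ((u * u^-1) * (v * v^-1)) ((v * v^-1) * (u * u^-1)).

Definition FI (X : Type) := sm_quot (@wagner X).

Section FI.
Variable X : Type.

HB.instance Definition _ := StarMonoid.on (FI X).

Let FI_mulgVg (a : FI X) : a * a^-1 * a = a.
Proof.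
have [u ->] := sm_piE a.
have /sm_piP := SmCongIncl (WagnerReg u).
by rewrite !(sm_piM, sm_piV).
Qed.
Let FI_mulgVC (a b : FI X) : (a * a^-1) * (b * b^-1) = (b * b^-1) * (a * a^-1).
Proof.
have [u ->] := sm_piE a; have [v ->] := sm_piE b.
have /sm_piP := SmCongIncl (WagnerComm u v).
by rewrite !(sm_piM, sm_piV).
Qed.
HB.instance Definition _ :=
  StarMonoid_isInverseMonoid.Build (FI X) FI_mulgVg FI_mulgVC.

Definition FI_gen (x : X) : FI X := sm_pi _ ([:: Pos x] : word X).

Lemma FI_pi (u : word X) : sm_pi _ u = word_val FI_gen u.
Proof.
elim: u => [|a u IH]; first by rewrite /word_val big_nil.
rewrite /word_val big_cons -[X in _ * X]IH.
transitivity (sm_pi (@wagner X) ([:: a] : word X) * sm_pi (@wagner X) u).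
  exact: (sm_piM _ ([:: a] : word X) u).
congr (_ * _).
by case: a => x //; exact: (sm_piV _ ([:: Pos x] : word X)).
Qed.

End FI.

Section FIUniversal.
Variables (X : Type) (M : invMonoidType) (f : X -> M).

Lemma word_valM : {morph word_val f : u v / u * v}.
Proof. by move=> u v; rewrite /word_val big_cat. Qed.

Lemma word_valV : {morph word_val f : u / u^-1}.
Proof.
move=> u; rewrite /= -[u^-1]/(word_inv u) /word_val; elim: u => [|a u IH].
  by rewrite !big_nil invg1.
rewrite /word_inv /= rev_cons big_rcons /= big_cons [RHS]invgM -IH.
by congr (_ * _); case: a => x //=; rewrite invgK.
Qed.

Definition FI_lift (a : FI X) : M := word_val f (sm_repr a).

Lemma FI_lift_pi u : FI_lift (sm_pi _ u) = word_val f u.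
Proof.
rewrite /FI_lift; move: (sm_piK (@wagner X) u); move: (sm_repr _) => w; elim=> {w u} //.
- by move=> _ _ [v|v w]; rewrite !(word_valM, word_valV) ?mulgVg // mulgVC.
- by move=> x y z _ -> _ ->.
- by move=> x x' y y' _ ex _ ey; rewrite !word_valM ex ey.
- by move=> x x' _ e; rewrite !word_valV e.
Qed.

Lemma FI_liftM : {morph FI_lift : a b / a * b}.
Proof.
move=> a b; have [u ->] := sm_piE a; have [v ->] := sm_piE b.
by rewrite -sm_piM !FI_lift_pi word_valM.
Qed.

Lemma FI_lift1 : FI_lift 1 = 1.
Proof. by rewrite -sm_pi1 FI_lift_pi /word_val big_nil. Qed.

Lemma FI_lift_gen x : FI_lift (FI_gen x) = f x.
Proof. by rewrite FI_lift_pi /word_val big_cons big_nil mulg1. Qed.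

End FIUniversal.

Definition Inv (X : Type) (R : FI X -> FI X -> Prop) := sm_quot R.

Section Inv.
Variables (X : Type) (R : FI X -> FI X -> Prop).

HB.instance Definition _ := StarMonoid.on (Inv R).

Let Inv_mulgVg (a : Inv R) : a * a^-1 * a = a.
Proof. have [u ->] := sm_piE a; have := congr1 (sm_pi R) (mulgVg u).
by rewrite !(sm_piM, sm_piV). Qed.
Let Inv_mulgVC (a b : Inv R) :
  (a * a^-1) * (b * b^-1) = (b * b^-1) * (a * a^-1).
Proof.
have [u ->] := sm_piE a; have [v ->] := sm_piE b.
have := congr1 (sm_pi R) (mulgVC u v); by rewrite !(sm_piM, sm_piV).
Qed.
HB.instance Definition _ :=
  StarMonoid_isInverseMonoid.Build (Inv R) Inv_mulgVg Inv_mulgVC.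

Definition Inv_gen (x : X) : Inv R := sm_pi R (FI_gen x).

End Inv.

Definition psi_free (X : Type) : FBR X -> FI X := FBR_lift (@FI_gen X).
HB.instance Definition _ X := BRMorphism.on (@psi_free X).

Section Psi.
Variables (X : Type) (R : FBR X -> FBR X -> Prop).

Inductive psi_rel : FI X -> FI X -> Prop :=
| PsiRel u v : R u v -> psi_rel (psi_free u) (psi_free v).

Notation S := (BRestr R).
Notation Stilde := (Inv psi_rel).

Definition psi (s : S) : Stilde := sm_pi psi_rel (psi_free (br_repr s)).

Lemma sm_pi_star (a : FI X) :
  sm_pi psi_rel (star a) = star (sm_pi psi_rel a : Stilde).
Proof. by rewrite !starE sm_piM sm_piV. Qed.

Lemma sm_pi_plus (a : FI X) :
  sm_pi psi_rel (plus a) = plus (sm_pi psi_rel a : Stilde).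
Proof. by rewrite !plusE sm_piM sm_piV. Qed.

Lemma psi_pi a : psi (br_pi R a) = sm_pi psi_rel (psi_free a).
Proof.
rewrite /psi; move: (br_piK R a); move: (br_repr _) => b; elim=> {a b} //.
- by move=> x y xy; apply/sm_piP/SmCongIncl; constructor.
- by move=> x y z _ -> _ ->.
- by move=> x x' y y' _ ex _ ey; rewrite !gmulfM /= ex ey.
- by move=> x x' _ e; rewrite !brmorph_star !sm_pi_star e.
- by move=> x x' _ e; rewrite !brmorph_plus !sm_pi_plus e.
Qed.

Lemma psi_gen x : psi (BRestr_gen R x) = Inv_gen psi_rel x.
Proof. by rewrite psi_pi /psi_free FBR_lift_gen. Qed.

Let psi1 : psi 1 = 1.
Proof. by rewrite psi_pi (gmulf1 (s := @psi_free X)). Qed.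
Let psiM : {morph psi : s t / s * t}.
Proof.
move=> s t; have [a ->] := br_piE s; have [b ->] := br_piE t.
by rewrite -br_piM !psi_pi !gmulfM.
Qed.
Let psi_star : {morph psi : s / star s}.
Proof.
move=> s; have [a ->] := br_piE s.
by rewrite -br_pi_star !psi_pi brmorph_star sm_pi_star.
Qed.
Let psi_plus : {morph psi : s / plus s}.
Proof.
move=> s; have [a ->] := br_piE s.
by rewrite -br_pi_plus !psi_pi brmorph_plus sm_pi_plus.
Qed.

HB.instance Definition _ := isUMagmaMorphism.Build S Stilde psi (conj psi1 psiM).
HB.instance Definition _ := isBRMorphism.Build S Stilde psi psi_star psi_plus.

Lemma psi_uniq (g : {brmorphism S -> Stilde}) :
  (forall x, g (BRestr_gen R x) = Inv_gen psi_rel x) -> g =1 psi.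
Proof.
move=> gE s; have [a ->] := br_piE s; rewrite psi_pi.
have [t ->] := br_piE a; elim: t => /= [x||t1 e1 t2 e2|t e|t e].
- by rewrite gE /psi_free FBR_lift_gen.
- by rewrite [LHS](gmulf1 (s := g)) [X in sm_pi _ X](gmulf1 (s := @psi_free X)).
- by rewrite (br_piM _ t1 t2) (br_piM R) !gmulfM /= e1 e2.
- by rewrite (br_pi_star _ t) (br_pi_star R) !brmorph_star sm_pi_star /= e.
- by rewrite (br_pi_plus _ t) (br_pi_plus R) !brmorph_plus sm_pi_plus /= e.
Qed.

(* D_(wa) is computed from D_w, whence a left fold (see D_word_rcons). *)
Definition D_step (d : S) (a : letter X) : S :=
  match a with
  | Pos x => star (d * BRestr_gen R x)
  | Neg x => plus (BRestr_gen R x * d)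
  end.

Definition D_word (u : word X) : S := foldl D_step 1 u.

Lemma D_word_rcons w a : D_word (rcons w a) = D_step (D_word w) a.
Proof. exact: foldl_rcons. Qed.

Lemma D_word_proj u : D_word u \in @is_proj S.
Proof.
elim/last_ind: u => [|w [x|x] _].
- by case: (is_proj_closed S).
- by rewrite D_word_rcons; apply/is_projP; eexists.
- by rewrite D_word_rcons; apply/is_proj_plus; eexists.
Qed.

Definition D_proj (u : word X) : proj S := Proj (D_word_proj u).

End Psi.

(* Main.v *)
(** A birestriction monoid S acts on its projections by p |-> (p s)^* and
    p |-> (s p)^+. These two maps determine each other through
    (p s)^* q = (p (s q)^+ s)^* and its mirror image, and pairs of maps of P(S)
    linked in this way form an inverse monoid, a variant of the Munn monoid of
    P(S). Since S maps to it, so does the universal inverse monoid; D_u is the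
    image of 1 under the map attached to the word u, hence depends only on the
    value of u. As psi (D_u) = u^-1 u, and a word representing psi p acts as
    multiplication by p, the maps psi and D are mutually inverse. *)

Require Import Defs.
From HB Require Import structures.
From mathcomp Require Import all_boot.
From mathcomp Require Import boolp.

Set Implicit Arguments.
Unset Strict Implicit.
Unset Printing Implicit Defensive.

Local Open Scope group_scope.

(** * The two actions on projections *)

Section BirestrictionFacts.
Variable S : brMonoidType.
Implicit Types (x y s : S) (p q : proj S).

(** By [star_mull] the left side is $y^*(xy)^*$, and $(xy)^*$ absorbs $y^*$. This makes the star
    action compatible with products. *)
Lemma star_mul_starl x y : star (star x * y) = star (x * y).
Proof.
rewrite star_mull star_mulr starC.
by rewrite -[in RHS](mulg_star y) mulgA star_mulr.
Qed.

Lemma plus_mul_plusr x y : plus (x * plus y) = plus (x * y).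
Proof.
rewrite plus_mulr plus_mull plusC.
by rewrite -[in RHS](plus_mulg x) -mulgA plus_mull.
Qed.

Lemma star_proj p : star (proj_val p) = proj_val p.
Proof. by case: p => _ /= /is_projP[x ->]; rewrite -(plus_star x) star_plus. Qed.

Lemma plus_proj p : plus (proj_val p) = proj_val p.
Proof. by rewrite -star_proj plus_star. Qed.

Lemma proj_inj : injective (@proj_val S).
Proof. exact: val_inj. Qed.

Lemma proj_valM p q : proj_val (p * q) = proj_val p * proj_val q.
Proof. exact: (gmulfM (s := val)). Qed.

Lemma star_is_proj x : star x \in @is_proj S.
Proof. by apply/is_projP; exists x. Qed.

Lemma plus_is_proj x : plus x \in @is_proj S.
Proof. by apply/is_proj_plus; exists x. Qed.

Definition act_star s p : proj S := Proj (star_is_proj (proj_val p * s)).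
Definition act_plus s p : proj S := Proj (plus_is_proj (s * proj_val p)).

(** Both sides equal $(psq)^*$: as $q=q^*=q^+$, it can be moved inside the star, and
    $sq=(sq)^+s$. *)
Lemma act_star_adj s p q : act_star s p * q = act_star s (p * act_plus s q).
Proof.
apply: proj_inj => /=; rewrite -[in LHS](star_proj q) -star_mulr star_proj.
by rewrite -!mulgA -[in LHS](plus_proj q) plus_mulr.
Qed.

Lemma act_plus_adj s p q : act_plus s p * q = act_plus s (p * act_star s q).
Proof.
rewrite projC (projC p); apply: proj_inj => /=.
rewrite -[in LHS](plus_proj q) -plus_mull plus_proj.
by rewrite !mulgA -[in LHS](star_proj q) star_mull.
Qed.

End BirestrictionFacts.

(** * The inverse monoid of linked pairs of maps *)

Section AdjointPairs.
Variable S : brMonoidType.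
Implicit Types p q : proj S.

(* Taking p = 1 in fwd_adj shows that fwd \o bwd is multiplication by fwd 1, *)
(* so such a pair restricts to mutually inverse isomorphisms between the     *)
(* principal ideals generated by bwd 1 and fwd 1.                            *)
Record adj_pair := AdjPair {
  fwd : proj S -> proj S;
  bwd : proj S -> proj S;
  fwd_adj : forall p q, fwd p * q = fwd (p * bwd q);
  bwd_adj : forall p q, bwd p * q = bwd (p * fwd q)
}.
Implicit Types a b c : adj_pair.

Lemma adj_pair_eq a b : fwd a =1 fwd b -> bwd a =1 bwd b -> a = b.
Proof.
case: a b => f g fg gf [f' g' fg' gf'] /= /funext ef /funext eg.
by subst f' g'; congr AdjPair; exact: Prop_irrelevance.
Qed.

HB.instance Definition _ := gen_eqMixin adj_pair.
HB.instance Definition _ := gen_choiceMixin adj_pair.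

Definition adj_one : adj_pair :=
  @AdjPair id id (fun _ _ => erefl) (fun _ _ => erefl).

Definition adj_inv a : adj_pair := AdjPair (bwd_adj a) (fwd_adj a).

Lemma adj_mul_fwd a b p q :
  fwd b (fwd a p) * q = fwd b (fwd a (p * bwd a (bwd b q))).
Proof. by rewrite fwd_adj fwd_adj. Qed.

Lemma adj_mul_bwd a b p q :
  bwd a (bwd b p) * q = bwd a (bwd b (p * fwd b (fwd a q))).
Proof. by rewrite bwd_adj bwd_adj. Qed.

(* Maps act on the right, so the left factor is applied first. *)
Definition adj_mul a b : adj_pair := AdjPair (adj_mul_fwd a b) (adj_mul_bwd a b).

Lemma adj_mulA : associative adj_mul.
Proof. by move=> a b c; apply: adj_pair_eq. Qed.
Lemma adj_mul1 : left_id adj_one adj_mul.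
Proof. by move=> a; apply: adj_pair_eq. Qed.
Lemma adj_invK : involutive adj_inv.
Proof. by move=> a; apply: adj_pair_eq. Qed.
Lemma adj_invM : {morph adj_inv : a b / adj_mul a b >-> adj_mul b a}.
Proof. by move=> a b; apply: adj_pair_eq. Qed.

HB.instance Definition _ := isStarMonoid.Build adj_pair
  adj_mulA adj_mul1 adj_invK adj_invM.

Lemma fwd_bwd a p : fwd a (bwd a p) = fwd a 1 * p.
Proof. by rewrite fwd_adj mul1g. Qed.

Lemma bwd_fwd a p : bwd a (fwd a p) = bwd a 1 * p.
Proof. exact: (fwd_bwd a^-1 p). Qed.

(** The factor [bwd a 1] produced by [bwd_fwd] is absorbed by [fwd a]: this is [fwd_adj] at
    $q=1$. *)
Lemma fwd_bwd_fwd a p : fwd a (bwd a (fwd a p)) = fwd a p.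
Proof. by rewrite bwd_fwd projC -fwd_adj mulg1. Qed.

Lemma adj_mulgVg a : a * a^-1 * a = a.
Proof.
apply: adj_pair_eq => p /=; first exact: fwd_bwd_fwd.
exact: (fwd_bwd_fwd a^-1 p).
Qed.

(** Each $aa^{-1}$ acts as multiplication by the projection [bwd a 1], and projections commute. *)
Lemma adj_mulgVC a b : (a * a^-1) * (b * b^-1) = (b * b^-1) * (a * a^-1).
Proof.
by apply: adj_pair_eq => p /=; rewrite !bwd_fwd !mulgA (projC (bwd a 1)).
Qed.

HB.instance Definition _ :=
  StarMonoid_isInverseMonoid.Build adj_pair adj_mulgVg adj_mulgVC.

Definition adj_of (s : S) : adj_pair :=
  AdjPair (@act_star_adj S s) (@act_plus_adj S s).

Lemma adj_of1 : adj_of 1 = 1.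
Proof.
apply: adj_pair_eq => p; apply: proj_inj => /=.
  by rewrite mulg1 star_proj.
by rewrite mul1g plus_proj.
Qed.

Lemma adj_ofM : {morph adj_of : s t / s * t}.
Proof.
move=> s t; apply: adj_pair_eq => p; apply: proj_inj => /=.
  by rewrite star_mul_starl mulgA.
by rewrite plus_mul_plusr mulgA.
Qed.

(** Both sides act as multiplication by $s^*$, the image of 1 under the star action of $s$. *)
Lemma adj_of_star : {morph adj_of : s / star s}.
Proof.
move=> s; rewrite starE; apply: adj_pair_eq => p /=.
all: rewrite [RHS](fwd_bwd (adj_of s)); apply: proj_inj.
all: rewrite /= mul1g.
  by rewrite star_mulr starC star_proj.
by rewrite -{1}plus_star plus_mull plus_star plus_proj.
Qed.

Lemma adj_of_plus : {morph adj_of : s / plus s}.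
Proof.
move=> s; rewrite Defs.plusE; apply: adj_pair_eq => p /=.
all: rewrite [RHS](bwd_fwd (adj_of s)); apply: proj_inj.
all: rewrite /= mulg1.
  by rewrite -{1}star_plus star_mulr starC star_plus star_proj.
by rewrite plus_mull plus_proj.
Qed.

HB.instance Definition _ :=
  isUMagmaMorphism.Build S adj_pair adj_of (conj adj_of1 adj_ofM).
HB.instance Definition _ :=
  isBRMorphism.Build S adj_pair adj_of adj_of_star adj_of_plus.

End AdjointPairs.

(** * Morphisms from [FI X] and their compatibility with quotients *)

Section FreeInverseLift.
Variables (X : Type) (M : invMonoidType) (f : X -> M).

Lemma FI_liftV : {morph FI_lift f : a / a^-1}.
Proof.
by move=> a; have [u ->] := sm_piE a; rewrite -sm_piV !FI_lift_pi word_valV.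
Qed.

Lemma FI_lift_star : {morph FI_lift f : a / star a}.
Proof. by move=> a; rewrite /= !starE FI_liftM FI_liftV. Qed.

Lemma FI_lift_plus : {morph FI_lift f : a / plus a}.
Proof. by move=> a; rewrite /= !Defs.plusE FI_liftM FI_liftV. Qed.

HB.instance Definition _ := isUMagmaMorphism.Build (FI X) M (FI_lift f)
  (conj (FI_lift1 f) (@FI_liftM X M f)).
HB.instance Definition _ :=
  isBRMorphism.Build (FI X) M (FI_lift f) FI_lift_star FI_lift_plus.

Lemma FI_lift_cong (Q : FI X -> FI X -> Prop) :
  (forall a b, Q a b -> FI_lift f a = FI_lift f b) ->
  forall a b, sm_pi Q a = sm_pi Q b -> FI_lift f a = FI_lift f b.
Proof.
move=> fQ a b /sm_piP; elim=> //.
- by move=> {}a {}b c _ -> _ ->.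
- by move=> a1 a2 b1 b2 _ ea _ eb; rewrite !FI_liftM ea eb.
- by move=> a1 a2 _ e; rewrite !FI_liftV e.
Qed.

Lemma sm_pi_word (Q : FI X -> FI X -> Prop) (u : word X) :
  sm_pi Q (sm_pi _ u) = word_val (Inv_gen Q) u.
Proof.
rewrite FI_pi; elim: u => [|a u IH]; first by rewrite /word_val !big_nil.
rewrite /word_val !big_cons sm_piM IH; congr (_ * _).
by case: a => x //=; rewrite sm_piV.
Qed.

End FreeInverseLift.

Lemma FBR_lift_comp (X : Type) (M N : brMonoidType) (f : X -> M)
    (g : {brmorphism M -> N}) (a : FBR X) :
  g (FBR_lift f a) = FBR_lift (g \o f) a.
Proof.
have [t ->] := br_piE a; rewrite !FBR_lift_pi.
elim: t => /= [//||t1 e1 t2 e2|t e|t e]; first exact: gmulf1.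
- by rewrite gmulfM /= e1 e2.
- by rewrite brmorph_star e.
- by rewrite brmorph_plus e.
Qed.

(** * The action of words, and the maps [psi] and [D] *)

Section UniversalInverseMonoid.
Variables (X : Type) (R : FBR X -> FBR X -> Prop).
Notation S := (BRestr R).
Notation Stilde := (Inv (psi_rel R)).
Implicit Types (u v : word X) (e : idem Stilde).

Definition adj_gen (x : X) : adj_pair S := adj_of (BRestr_gen R x).

(** Both sides are morphisms in [a] that agree on generators. Hence [FI_lift adj_gen] respects the
    relations [psi_rel R]. *)
Lemma FI_lift_psi_free (a : FBR X) :
  FI_lift adj_gen (psi_free a) = adj_of (br_pi R a : S).
Proof.
have -> : br_pi R a = FBR_lift (BRestr_gen R) a.
  pose pi : {brmorphism FBR X -> br_quot R} := br_pi R.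
  by refine (FBR_lift_uniq (M := S) (g := pi) _ a).
rewrite /psi_free !FBR_lift_comp; congr (FBR_lift _ a); apply/funext => x.
exact: FI_lift_gen.
Qed.

Lemma FI_lift_psi_rel (a b : FI X) :
  sm_pi (psi_rel R) a = sm_pi (psi_rel R) b ->
  FI_lift adj_gen a = FI_lift adj_gen b.
Proof.
apply: FI_lift_cong => _ _ [c d Rcd]; rewrite !FI_lift_psi_free.
by congr adj_of; apply/br_piP/BrCongIncl.
Qed.

Lemma D_wordE u : D_word R u = proj_val (fwd (FI_lift adj_gen (sm_pi _ u)) 1).
Proof.
(* The initial value 1 is exposed as a projection so that the induction can run over all starting
   projections. *)
rewrite FI_lift_pi -[LHS]/(foldl (@D_step X R) (proj_val (1 : proj S)) u).
elim: u (1 : proj S) => [|a u IH] p; first by rewrite /word_val big_nil.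
by rewrite /word_val big_cons /= -IH; case: a.
Qed.

Lemma D_word_wd u v :
  word_val (Inv_gen (psi_rel R)) u = word_val (Inv_gen (psi_rel R)) v ->
  D_word R u = D_word R v.
Proof. by rewrite -!sm_pi_word => /FI_lift_psi_rel e; rewrite !D_wordE e. Qed.

Lemma psi_D_word u : psi (D_word R u) = star (word_val (Inv_gen (psi_rel R)) u).
Proof.
elim/last_ind: u => [|u a IH].
  by rewrite /word_val big_nil star1 (gmulf1 (s := @psi X R)).
rewrite D_word_rcons /word_val big_rcons /= -/(word_val _ u).
case: a => x /=.
  by rewrite brmorph_star gmulfM /= psi_gen IH star_mul_starl.
(* With $w$ the value of [u], both sides reduce to $xw^{-1}wx^{-1}$, because $w^{-1}w$ is
   idempotent. *)
rewrite brmorph_plus gmulfM /= psi_gen IH Defs.plusE [in RHS]starE !invgM !invgK.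
by rewrite -starE -mulgA (mulgA (star _)) starg_idem starE !mulgA.
Qed.

Lemma D_word_psi (p : proj S) u :
  word_val (Inv_gen (psi_rel R)) u = psi (proj_val p) -> D_word R u = proj_val p.
Proof.
have [a pa] := br_piE (proj_val p).
rewrite -sm_pi_word pa psi_pi => /FI_lift_psi_rel; rewrite D_wordE => ->.
by rewrite FI_lift_psi_free -pa /= mul1g star_proj.
Qed.

Lemma psi_is_idem (p : proj S) : psi (proj_val p) \in @is_idem Stilde.
Proof. by rewrite unfold_in /is_idem -gmulfM -proj_valM projgg. Qed.

Definition psi_proj (p : proj S) : idem Stilde := Idem (psi_is_idem p).

(** Representatives are chosen twice, first in [FI X] and then among words; by [D_word_wd] the
    choice does not affect [D_idem]. *)
Definition idem_word e : word X := sm_repr (sm_repr (idem_val e)).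

Lemma idem_wordK e : word_val (Inv_gen (psi_rel R)) (idem_word e) = idem_val e.
Proof. by rewrite -sm_pi_word !sm_reprK. Qed.

Definition D_idem e : proj S := D_proj R (idem_word e).

Lemma D_idemE e u :
  word_val (Inv_gen (psi_rel R)) u = idem_val e -> D_idem e = D_proj R u.
Proof. by move=> ue; apply: proj_inj; apply: D_word_wd; rewrite idem_wordK. Qed.

Lemma psi_projK : cancel psi_proj D_idem.
Proof. by move=> p; apply: proj_inj; apply: D_word_psi; rewrite idem_wordK. Qed.

Lemma D_idemK : cancel D_idem psi_proj.
Proof.
move=> e; apply: val_inj; rewrite /= psi_D_word idem_wordK.
by case: e => x /= /eqP xx; rewrite starE (idemV xx).
Qed.

Lemma psi_projM : {morph psi_proj : p q / p * q}.
Proof. by move=> p q; apply: val_inj; rewrite /= gmulfM. Qed.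

End UniversalInverseMonoid.

Theorem proposition4p3 (X : Type) (X_nonempty : inhabited X)
    (R : FBR X -> FBR X -> Prop) :
  exists (psiP : proj (BRestr R) -> idem (Inv (psi_rel R)))
         (D : idem (Inv (psi_rel R)) -> proj (BRestr R)),
    (* psiP and D are well defined, i.e. each is the one and only map
       satisfying its description *)
    unique (fun f => forall p, idem_val (f p) = psi (proj_val p)) psiP /\
    unique (fun f => forall e u, word_val (Inv_gen (psi_rel R)) u = idem_val e ->
                                 f e = D_proj R u) D /\
    cancel psiP D /\
    cancel D psiP /\
    {morph psiP : p q / p * q} /\
    {morph D : e f / e * f}.
Proof.
exists (@psi_proj X R), (@D_idem X R); split.
  by split=> // f fE; apply/funext => p; apply: val_inj; rewrite /= fE.
split.
  split; first exact: D_idemE.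
  (* Every idempotent is the value of some word, so the description leaves no freedom. *)
  by move=> f fE; apply/funext => e; rewrite (fE e _ (idem_wordK e)).
split; first exact: psi_projK.
split; first exact: D_idemK.
split; first exact: psi_projM.
by move=> e f; apply: (can_inj (@psi_projK X R)); rewrite psi_projM !D_idemK.
Qed.
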